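(* Let $L,d,T,n,M\ge 1$ be integers, let $V$ be the set of (fuzzy) states, and let $f_1,\dots,f_n:V\to V$ be maps (the DSL transformations), written $\tilde\psi=f_s(\psi)$. Assume that every $f_s$ satisfies the following two conditions for every $\psi\in V$: (a) $\tilde\psi$ is a non-null sharp state if and only if $\psi$ is a non-null sharp state; (b) if $$\sum_k \psi_{1,0,k}+\sum_{i=2}^{L+1}\sum_k \psi_{i,j_i,k}\le 1$$ for all choices of indices $0\le j_i\le i-2$ ($2\le i\le L+1$), then $$\sum_k \tilde\psi_{1,0,k}+\sum_{i=2}^{L+1}\sum_k \tilde\psi_{i,j_i,k}\le 1$$ for all choices of indices $0\le j_i\le i-2$ ($2\le i\le L+1$). Let $\Psi_{in}=(\Psi_{in,m})_{m=1}^M$ and $\hat\Psi=(\hat\Psi_m)_{m=1}^M$ be families of non-null sharp states (the input and ground-truth output examples). For a matrix $\pi=(\pi_{ts})_{1\le t\le T,\,1\le s\le n}$ with $\pi_{ts}\ge 0$ and $\sum_s\pi_{ts}=1$ for every $t$, let $L(\pi)\in[0,\infty]$ be the loss defined in the context. If $\pi^*$ is such a matrix with $L(\pi^* )=0$, then $$f_{\mathrm{argmax}_s \pi^*_{Ts}}\circ\cdots\circ f_{\mathrm{argmax}_s \pi^*_{2s}}\circ f_{\mathrm{argmax}_s \pi^*_{1s}}(\Psi_{in})=\hat\Psi .$$ Here $\mathrm{argmax}_s\pi^*_{ts}$ denotes any index $s$ maximizing $\pi^*_{ts}$, and the maps $f_s$ act on families of states componentwise in $m$.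
   Context: Indices. Tensors have entries $\psi_{i,j,k}$ with $0\le j\le L-1$ and $0\le k\le d-1$. The index $i$ encodes the type of a variable: $i=0$ is null, $i=1$ is an integer, and $i=\ell+1$ is a list of length $\ell$ with $1\le \ell\le L$. The index $j$ is the position in the list, and $k$ encodes an integer value (one of $d$ consecutive allowed integers). The null component $\psi_{0,0,0}$ is discarded throughout, so only $1\le i\le L+1$ is considered. States. $V$ is the set of tensors $(\psi_{i,j,k})_{1\le i\le L+1,\ 0\le j\le L-1,\ 0\le k\le d-1}$ with nonnegative real entries that vanish outside the allowed positions. The allowed positions are $(1,0,k)$, and $(i,j,k)$ with $2\le i\le L+1$ and $0\le j\le i-2$. Non-null sharp states. These are the elements of $V$ of one of the following two forms: - integer: for some $k_0$, $\psi_{1,0,k_0}=1$ and all other entries are $0$; - list of length $\ell$, $1\le \ell\le L$: for some $k_0,\dots,k_{\ell-1}\in\{0,\dots,d-1\}$, $\psi_{\ell+1,j,k_j}=1$ for $0\le j\le \ell-1$ and all other entries are $0$. Evolution. Given $\pi$ and $\Psi_{in}$, define families of states $\Psi_{(t)}=(\Psi_{(t),m})_{m=1}^M$ by $\Psi_{(0)}=\Psi_{in}$ and $$\Psi_{(t),m}=\sum_{s=1}^n \pi_{ts}\,f_s(\Psi_{(t-1),m}),\qquad 1\le t\le T,$$ and set $\Psi_{out}=\Psi_{(T)}$. Loss. Writing $\Psi=\Psi_{out}$, $$L(\pi)=-\frac1N\sum_{m}\sum_{i\ne 0,\,j,\,k}\hat\Psi_{m,i,j,k}\,\log\Psi_{m,i,j,k},\qquad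 N=\sum_{m}\sum_{i\neq 0,\,j,\,k}\hat\Psi_{m,i,j,k},$$ where terms with $\hat\Psi_{m,i,j,k}=0$ are counted as $0$ and $-\log 0=+\infty$. (The loss function $L(\pi)$ is not to be confused with the maximal list length $L$.) *)

(* Defs.v *)
From mathcomp Require Export all_boot all_order all_algebra.
From mathcomp Require Export all_classical all_reals all_analysis.

Set Implicit Arguments.
Unset Strict Implicit.
Unset Printing Implicit Defensive.

Import Order.TTheory GRing.Theory Num.Theory.

Local Open Scope classical_set_scope.
Local Open Scope ring_scope.

(* The null type is discarded, so types are indexed from 0: the ordinal
   i : 'I_L.+1 stands for the type index i.+1 in {1, ..., L+1}.  Thus i = 0 is
   the integer type and i = l > 0 is the type of lists of length l. *)
Definition tensor (R : realType) (L d : nat) : Type :=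
  {ffun 'I_L.+1 * 'I_L * 'I_d -> R}.

Definition allowed (L : nat) (i : 'I_L.+1) (j : 'I_L) : bool :=
  if i == 0%N :> nat then j == 0%N :> nat else (j < i)%N.

Definition states (R : realType) (L d : nat) : set (tensor R L d) :=
  [set psi | (forall i j k, 0 <= psi (i, j, k)) /\
             (forall i j k, ~~ allowed i j -> psi (i, j, k) = 0)].

Definition sharp_integer (R : realType) (L d : nat) (psi : tensor R L d) : Prop :=
  exists k0 : 'I_d, forall i j k,
    psi (i, j, k) = [&& i == 0%N :> nat, j == 0%N :> nat & k == k0]%:R.

(* Only the values of ks at positions below l matter. *)
Definition sharp_list (R : realType) (L d : nat) (l : nat) (psi : tensor R L d) :
    Prop :=
  exists ks : 'I_L -> 'I_d, forall i j k,
    psi (i, j, k) = [&& i == l :> nat, (j < l)%N & k == ks j]%:R.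

Definition sharp (R : realType) (L d : nat) : set (tensor R L d) :=
  [set psi | states psi /\
     (sharp_integer psi \/
      exists l : nat, (1 <= l <= L)%N /\ sharp_list l psi)].

(* J selects one allowed position in every type; allowedness forces position 0
   for the integer type, so the term at i = 0 is the sum over k of the integer
   entries. *)
Definition selection_le1 (R : realType) (L d : nat) (psi : tensor R L d) : Prop :=
  forall J : 'I_L.+1 -> 'I_L, (forall i, allowed i (J i)) ->
    \sum_(i < L.+1) \sum_(k < d) psi (i, J i, k) <= 1.

Definition row_stochastic (R : realType) (T n : nat) (pi : 'M[R]_(T, n)) : Prop :=
  (forall t s, 0 <= pi t s) /\ (forall t, \sum_(s < n) pi t s = 1).

Definition step (R : realType) (L d T n : nat)
    (f : 'I_n -> tensor R L d -> tensor R L d) (pi : 'M[R]_(T, n))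
    (psi : tensor R L d) (t : 'I_T) : tensor R L d :=
  [ffun p => \sum_(s < n) pi t s * f s psi p].

(* enum 'I_T lists the time steps in increasing order. *)
Definition evolve (R : realType) (L d T n : nat)
    (f : 'I_n -> tensor R L d -> tensor R L d) (pi : 'M[R]_(T, n))
    (psi : tensor R L d) : tensor R L d :=
  foldl (step f pi) psi (enum 'I_T).

Definition run (R : realType) (L d T n : nat)
    (f : 'I_n -> tensor R L d -> tensor R L d) (sigma : 'I_T -> 'I_n)
    (psi : tensor R L d) : tensor R L d :=
  foldl (fun phi t => f (sigma t) phi) psi (enum 'I_T).

(* lne 0 = -oo, and 0 * -oo = 0 in \bar R, so entries with target 0 contribute 0. *)
Definition cross_entropy (R : realType) (L d M : nat)
    (target out : 'I_M -> tensor R L d) : \bar R :=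
  let N : R := \sum_(m < M) \sum_p target m p in
  (- ((N^-1)%:E *
      \sum_(m < M) \sum_p (target m p)%:E * lne (out m p)%:E))%E.

Definition loss (R : realType) (L d T n M : nat)
    (f : 'I_n -> tensor R L d -> tensor R L d)
    (input target : 'I_M -> tensor R L d) (pi : 'M[R]_(T, n)) : \bar R :=
  cross_entropy target (fun m => evolve f pi (input m)).

(* Main.v *)
(* A state whose selection sums are at most 1 and which equals 1 at every support
   entry of a sharp state coincides with that sharp state: all its other entries
   share a selection with an entry equal to 1.  Hence a zero loss forces the
   output to equal the target, and a sharp state is an extreme point among the
   states with selection sums at most 1, so every map of positive weight in the
   last step, in particular the argmax, sends the previous state to the target.
   That previous state is then sharp by (a), and the argument repeats backwards
   in time. *)

Require Import Defs.

Import Order.TTheory GRing.Theory Num.Theory.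
Local Open Scope classical_set_scope.
Local Open Scope ring_scope.

Set Implicit Arguments.
Unset Strict Implicit.

(** One pattern covers both kinds of sharp state: in type [i0], [allowed] forces position 0 for an
    integer and positions below the length for a list. *)
Lemma sharpE (R : realType) (L d : nat) (psi : tensor R L d) :
  sharp psi -> exists i0 : 'I_L.+1, exists ks : 'I_L -> 'I_d, forall i j k,
    psi (i, j, k) = [&& i == i0, allowed i j & k == ks j]%:R.
Proof.
case=> _ [[k0 psiE]|[l [/andP[l_gt0 l_le] [ks psiE]]]].
  exists ord0, (fun=> k0) => i j k; rewrite psiE /allowed -(val_eqE i) /=.
  by case: (nat_of_ord i == 0)%N.
exists (Ordinal (l_le : (l < L.+1)%N)), ks => i j k.
rewrite psiE /allowed -(val_eqE i) /=; case: eqP => //= ->.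
by rewrite eqn0Ngt l_gt0.
Qed.

Lemma allowed_ord0 (L : nat) (i : 'I_L.+1) (L_gt0 : (0 < L)%N) :
  allowed i (Ordinal L_gt0).
Proof. by rewrite /allowed; case: eqP => //= /eqP; rewrite lt0n. Qed.

(** A selection meets the support of a sharp state at most once: only in type [i0], and there only
    at the value [ks (J i0)]. *)
Lemma sharp_selection_le1 (R : realType) (L d : nat) (psi : tensor R L d) :
  sharp psi -> selection_le1 psi.
Proof.
move=> /sharpE[i0 [ks psiE]] J J_allowed.
rewrite (bigD1 i0) //= [X in _ + X]big1 ?addr0 => [|i /negPf i_neq]; last first.
  by rewrite big1 // => k _; rewrite psiE i_neq.
rewrite (bigD1 (ks (J i0))) //= big1 ?addr0 => [|k /negPf k_neq].
  by rewrite psiE; case: [&& _, _ & _]; rewrite ?ler01.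
by rewrite psiE k_neq !andbF.
Qed.

Lemma entry_le1 (R : realType) (L d : nat) (psi : tensor R L d) p :
  states psi -> selection_le1 psi -> psi p <= 1.
Proof.
case: p => -[i j] k [psi_ge0 psi_null] psi_le1.
have L_gt0 : (0 < L)%N by case: (j) => m; apply: leq_ltn_trans.
have [ij|/psi_null->] := boolP (allowed i j); last exact: ler01.
pose J a := if a == i then j else Ordinal L_gt0.
have J_allowed a : allowed a (J a).
  by rewrite /J; case: eqP => [->//|_]; apply: allowed_ord0.
apply: le_trans (psi_le1 J J_allowed).
rewrite (bigD1 i) //= (bigD1 k) //= {1}/J eqxx -addrA lerDl.
apply: addr_ge0; first exact: sumr_ge0.
by apply: sumr_ge0 => a _; apply: sumr_ge0.
Qed.

(** The condition [i' = i -> j' = j] lets a single selection pass through both positions;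
    [(i', k') != (i, k)] makes the two entries distinct terms of its sum. *)
Lemma two_entries_le1 (R : realType) (L d : nat) (psi : tensor R L d)
    i j k i' j' k' :
  states psi -> selection_le1 psi -> allowed i j -> allowed i' j' ->
  (i' = i -> j' = j) -> (i', k') != (i, k) ->
  psi (i, j, k) + psi (i', j', k') <= 1.
Proof.
move=> [psi_ge0 _] psi_le1 ij ij' jj' neq.
have L_gt0 : (0 < L)%N by case: (j) => m; apply: leq_ltn_trans.
pose J a := if a == i then j else if a == i' then j' else Ordinal L_gt0.
have J_allowed a : allowed a (J a).
  rewrite /J; case: eqP => [->//|_]; case: eqP => [->//|_].
  exact: allowed_ord0.
have Ji : J i = j by rewrite /J eqxx.
have Ji' : J i' = j' by rewrite /J eqxx; case: eqP => // /jj'.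
apply: le_trans (psi_le1 J J_allowed).
rewrite pair_bigA /= (bigD1 (i, k)) //= (bigD1 (i', k')) //= Ji Ji' addrA lerDl.
exact: sumr_ge0.
Qed.

Lemma sharp_maximal (R : realType) (L d : nat) (tgt psi : tensor R L d) :
  sharp tgt -> states psi -> selection_le1 psi ->
  (forall p, tgt p = 1 -> psi p = 1) -> psi = tgt.
Proof.
move=> tgt_sharp psi_st psi_le1 psi1.
have [_ tgt_null] := tgt_sharp.1; have [psi_ge0 psi_null] := psi_st.
have [i0 [ks tgtE]] := sharpE tgt_sharp.
apply/ffunP => -[[i j] k].
have L_gt0 : (0 < L)%N by case: (j) => m; apply: leq_ltn_trans.
have [ij|nij] := boolP (allowed i j); last by rewrite psi_null // tgt_null.
have [in_tgt|notin_tgt] := boolP [&& i == i0, allowed i j & k == ks j].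
  by rewrite psi1 tgtE in_tgt.
rewrite tgtE (negPf notin_tgt) /=.
(* A support position of [tgt] that can share a selection with [(i, j)]: within the same type it has
   to be [j] itself, otherwise position 0 will do. *)
pose j' := if i0 == i then j else Ordinal L_gt0.
have ij' : allowed i0 j'.
  by rewrite /j'; case: eqP => [->//|_]; apply: allowed_ord0.
have neq : (i0, ks j') != (i, k).
  apply: contra notin_tgt => /eqP[i0E <-].
  by rewrite ij /j' i0E !eqxx.
have jj' : i0 = i -> j' = j by rewrite /j' => ->; rewrite eqxx.
have := two_entries_le1 psi_st psi_le1 ij ij' jj' neq.
rewrite [psi (i0, _, _)]psi1; last by rewrite tgtE ij' !eqxx.
by rewrite gerDr => psi_le0; apply/le_anti; rewrite psi_le0 psi_ge0.
Qed.

Section ConvexCombination.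
Variables (R : realType) (L d n : nat) (w : 'I_n -> R).
Variable phi : 'I_n -> tensor R L d.
Hypotheses (w_ge0 : forall s, 0 <= w s) (w_sum1 : \sum_s w s = 1).
Hypothesis phi_states : forall s, states (phi s).
Hypothesis phi_le1 : forall s, selection_le1 (phi s).

Let mix : tensor R L d := [ffun p => \sum_s w s * phi s p].

Lemma states_mix : states mix.
Proof.
split=> i j k => [|nij]; rewrite ffunE.
  by apply: sumr_ge0 => s _; rewrite mulr_ge0 //; have [] := phi_states s.
by rewrite big1 // => s _; have [_ ->//] := phi_states s; rewrite mulr0.
Qed.

Lemma selection_le1_mix : selection_le1 mix.
Proof.
move=> J J_allowed.
have -> : \sum_(i < L.+1) \sum_(k < d) mix (i, J i, k) =
    \sum_s w s * \sum_(i < L.+1) \sum_(k < d) phi s (i, J i, k).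
  under eq_bigr do under eq_bigr do rewrite ffunE.
  under eq_bigr do rewrite exchange_big.
  rewrite exchange_big; apply: eq_bigr => s _; rewrite mulr_sumr.
  by apply: eq_bigr => i _; rewrite mulr_sumr.
rewrite -w_sum1; apply: ler_sum => s _.
by rewrite ler_piMr // phi_le1.
Qed.

(** A weighted mean of numbers at most 1 equals 1 only if every term of positive weight is 1, so
    [phi s] is 1 on the support of [mix]. *)
Lemma mix_sharp s : sharp mix -> 0 < w s -> phi s = mix.
Proof.
move=> mixS ws_gt0; apply: sharp_maximal => // p mix1.
have gap_ge0 r : true -> 0 <= w r * (1 - phi r p).
  by move=> _; rewrite mulr_ge0 // subr_ge0 entry_le1.
have gap0 : \sum_r w r * (1 - phi r p) = 0.
  under eq_bigr do rewrite mulrBr mulr1.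
  by rewrite sumrB w_sum1; move: mix1; rewrite ffunE => ->; rewrite subrr.
have /eqP := psumr_eq0P gap_ge0 gap0 (erefl : xpredT s).
by rewrite mulf_eq0 gt_eqF //= subr_eq0 => /eqP.
Qed.

End ConvexCombination.

Lemma cross_entropy_eq0 (R : realType) (L d M : nat)
    (target out : 'I_M -> tensor R L d) :
  (forall m, sharp (target m)) -> (forall m p, out m p <= 1) ->
  cross_entropy target out = 0%E ->
  forall m p, target m p = 1 -> out m p = 1.
Proof.
move=> target_sharp out_le1 ce0 m p tmp.
have target_ge0 m' q : 0 <= target m' q.
  by case: q => -[i j] k; case: (target_sharp m') => -[].
(* Needed to cancel the factor [N^-1], which is 0 by convention when [N] is 0. *)
have N_gt0 : 0 < \sum_(m < M) \sum_p target m p.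
  rewrite (bigD1 m) //= (bigD1 p) //= tmp -addrA ltr_pwDl ?ltr01 //.
  by rewrite addr_ge0 ?sumr_ge0 // => m' _; rewrite sumr_ge0.
pose F m' q := ((target m' q)%:E * lne (out m' q)%:E)%E.
have F_le0 m' q : (F m' q <= 0)%E.
  by rewrite mule_ge0_le0 ?lee_fin // lne_le0 lee_fin.
have F_sum0 : (\sum_(m' < M) \sum_q F m' q = 0)%E.
  apply/eqP; move/eqP: ce0; rewrite /cross_entropy oppe_eq0 mule_eq0 eqe.
  by rewrite invr_eq0 gt_eqF.
(* All terms are nonpositive, so each one is at least the total, which is 0. *)
have Fmp_ge0 : (0 <= F m p)%E.
  rewrite -F_sum0 (bigD1 m) //= (bigD1 p) //= -addeA geeDl //.
  by apply: adde_le0; apply: sume_le0 => // m' _; apply: sume_le0.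
have /eqP : F m p = 0%E by apply/le_anti; rewrite F_le0.
by rewrite /F tmp mul1e lne_eq0 => /eqP[].
Qed.

Theorem theorem1 (R : realType) (L d T n M : nat)
    (L_gt0 : (0 < L)%N) (d_gt0 : (0 < d)%N) (T_gt0 : (0 < T)%N)
    (n_gt0 : (0 < n)%N) (M_gt0 : (0 < M)%N)
    (f : 'I_n -> tensor R L d -> tensor R L d)
    (f_states : forall s psi, states psi -> states (f s psi))
    (f_sharp : forall s psi, states psi -> (sharp (f s psi) <-> sharp psi))
    (f_le1 : forall s psi, states psi ->
       selection_le1 psi -> selection_le1 (f s psi))
    (input target : 'I_M -> tensor R L d)
    (input_sharp : forall m, sharp (input m))
    (target_sharp : forall m, sharp (target m))
    (pi : 'M[R]_(T, n)) (pi_stochastic : row_stochastic pi)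
    (loss0 : loss f input target pi = 0%E)
    (sigma : 'I_T -> 'I_n)
    (sigma_argmax : forall t s, pi t s <= pi t (sigma t)) :
  forall m, run f sigma (input m) = target m.
Proof.
have [pi_ge0 pi_sum1] := pi_stochastic.
have step_ok t psi : states psi -> selection_le1 psi ->
    states (step f pi psi t) /\ selection_le1 (step f pi psi t).
  move=> psi_st psi_le1; split; first by apply: states_mix => // s; apply: f_states.
  by apply: selection_le1_mix => // s; apply: f_le1.
have foldl_ok ts psi : states psi -> selection_le1 psi ->
    states (foldl (step f pi) psi ts) /\ selection_le1 (foldl (step f pi) psi ts).
  elim: ts psi => //= t ts IHts psi psi_st psi_le1.
  by have [] := step_ok t psi psi_st psi_le1; apply: IHts.
(* If the largest entry of a row were 0, the row could not sum to 1. *)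
have pi_sigma_gt0 t : 0 < pi t (sigma t).
  rewrite lt0r pi_ge0 andbT; apply/eqP => pi0.
  have /eqP := pi_sum1 t; rewrite big1 ?(eq_sym 0) ?oner_eq0 // => s _.
  by apply/le_anti; rewrite pi_ge0 -pi0 sigma_argmax.
have backward ts psi : sharp psi -> sharp (foldl (step f pi) psi ts) ->
    foldl (fun phi t => f (sigma t) phi) psi ts = foldl (step f pi) psi ts.
  move=> psi_sharp.
  have [psi_st psi_le1] := (psi_sharp.1, sharp_selection_le1 psi_sharp).
  (* The last step is peeled off first, since sharpness is known at the end and travels
     backwards. *)
  elim/last_ind: ts => // ts t IHts; rewrite !foldl_rcons => step_sharp.
  have [phi_st phi_le1] := foldl_ok ts psi psi_st psi_le1.
  have fE : f (sigma t) (foldl (step f pi) psi ts) =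
      step f pi (foldl (step f pi) psi ts) t.
    apply: (mix_sharp (pi_ge0 t) (pi_sum1 t)
      (phi := fun s => f s (foldl (step f pi) psi ts))) => // s.
      exact: f_states.
    exact: f_le1.
  (* Condition (a), read from output to input, supplies the sharpness that [IHts] requires of the
     previous state. *)
  by rewrite IHts //; apply/(f_sharp (sigma t) _ phi_st); rewrite fE.
move=> m.
have out_ok m' : states (evolve f pi (input m')) /\
    selection_le1 (evolve f pi (input m')).
  exact: foldl_ok (input_sharp m').1 (sharp_selection_le1 (input_sharp m')).
have outE : evolve f pi (input m) = target m.
  have [out_st out_le1] := out_ok m; apply: sharp_maximal => //.
  apply: (cross_entropy_eq0 target_sharp _ loss0) => m' p.
  by have [] := out_ok m'; apply: entry_le1.
by rewrite -outE; apply: backward => //; rewrite [X in sharp X]outE.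
Qed.
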